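(* Let $\lambda$ be a nonzero real number. For all $m,n \in \mathbb{N}$, \[ K_{n,\lambda}^{(m)}=\sum_{j=1}^n \frac1{j!} \sum_{k=1}^j \frac{(-1)^{k-1}}{k^m} \binom{\lambda+k-1}{k-1}\,k!\, L(j,k). \]
   Context: For real $x$ and integer $k\ge0$, $\binom{x}{k}=\frac{x(x-1)\cdots(x-k+1)}{k!}$. The unsigned Lah numbers are $L(n,k)=\binom{n-1}{k-1}\frac{n!}{k!}$ for $n\ge k\ge1$. For a nonzero real $\mu$ and integer $m$, the degenerate polylogarithm is the power series $\mathrm{Li}_{m,\mu}(t)=\sum_{n=1}^\infty \frac{(-1)^{n-1}}{n^m}\binom{\mu-1}{n-1}t^n$. For $m\ge1$, the numbers $K^{(m)}_{n,\lambda}$ ($n\ge1$) are defined by the formal power series identity \[ \frac{-1}{1-t}\mathrm{Li}_{m,-\lambda}\left(\frac{-t}{1-t}\right)=\sum_{n=1}^\infty K_{n,\lambda}^{(m)}\, t^n . \] *)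

(* Defs.v *)
From HB Require Import structures.
From mathcomp Require Import all_boot all_order all_algebra.
From mathcomp Require Import boolp reals.

Set Implicit Arguments.
Unset Strict Implicit.
Unset Printing Implicit Defensive.

Import Order.TTheory GRing.Theory Num.Theory.

Local Open Scope ring_scope.

(* Formal power series over a field, as a commutative ring with inverses.
   The record wrapper keeps the Cauchy product apart from the pointwise ring
   structure on functions nat -> F. *)
Record fps (F : fieldType) : Type := Fps { fps_coef :> nat -> F }.

Section FpsRing.
Variable F : fieldType.
Implicit Types f g h : fps F.

Lemma fpsP f g : (forall n, f n = g n) <-> f = g.
Proof.
split=> [|-> //]; case: f g => [f] [g] /= fg.
by congr Fps; apply/funext.
Qed.

HB.instance Definition _ := gen_eqMixin (fps F).
HB.instance Definition _ := gen_choiceMixin (fps F).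

Definition fps_add f g := Fps (fun n => f n + g n).
Definition fps_opp f := Fps (fun n => - f n).
Definition fps_const (a : F) := Fps (fun n => if n == 0%N then a else 0).
Definition fps_mul f g := Fps (fun n => \sum_(i < n.+1) f i * g (n - i)%N).

Lemma fps_addA : associative fps_add.
Proof. by move=> f g h; apply/fpsP => n /=; rewrite addrA. Qed.
Lemma fps_addC : commutative fps_add.
Proof. by move=> f g; apply/fpsP => n /=; rewrite addrC. Qed.
Lemma fps_add0 : left_id (fps_const 0) fps_add.
Proof. by move=> f; apply/fpsP => n /=; rewrite if_same add0r. Qed.
Lemma fps_addN : left_inverse (fps_const 0) fps_opp fps_add.
Proof. by move=> f; apply/fpsP => n /=; rewrite if_same addNr. Qed.

HB.instance Definition _ :=
  GRing.isZmodule.Build (fps F) fps_addA fps_addC fps_add0 fps_addN.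

Definition fps_trunc (N : nat) f : {poly F} := \poly_(i < N) f i.

Lemma fps_mul_trunc N f g n : (n < N)%N ->
  fps_mul f g n = (fps_trunc N f * fps_trunc N g)`_n.
Proof.
move=> nN; rewrite coefM /=; apply: eq_bigr => i _; rewrite !coef_poly.
rewrite (leq_ltn_trans _ nN) ?(leq_ltn_trans _ nN) ?leq_subr //.
by rewrite -ltnS.
Qed.

Lemma fps_mulC : commutative fps_mul.
Proof.
by move=> f g; apply/fpsP => n; rewrite !(fps_mul_trunc _ _ (ltnSn n)) mulrC.
Qed.

Lemma coef_trunc_mull N f g (p : {poly F}) n : (n < N)%N ->
  (fps_trunc N (fps_mul f g) * p)`_n = (fps_trunc N f * fps_trunc N g * p)`_n.
Proof.
move=> nN; rewrite !coefM; apply: eq_bigr => i _; congr (_ * _).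
have iN : (i < N)%N by apply: leq_ltn_trans nN; rewrite -ltnS.
by rewrite coef_poly iN (fps_mul_trunc _ _ iN).
Qed.

Lemma fps_mulA : associative fps_mul.
Proof.
move=> f g h; apply/fpsP => n; rewrite [fps_mul f _]fps_mulC.
rewrite !(fps_mul_trunc _ _ (ltnSn n)) !coef_trunc_mull //.
by rewrite mulrC mulrA.
Qed.

Lemma fps_mul1 : left_id (fps_const 1) fps_mul.
Proof.
move=> f; apply/fpsP => n /=; rewrite big_ord_recl /= mul1r subn0.
by rewrite big1 ?addr0 // => i _; rewrite mul0r.
Qed.

Lemma fps_mulDl : left_distributive fps_mul +%R.
Proof.
move=> f g h; apply/fpsP => n /=; rewrite -big_split /=.
by apply: eq_bigr => i _; rewrite mulrDl.
Qed.

Lemma fps_one_neq0 : fps_const 1 != 0.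
Proof.
by apply/eqP => /fpsP /(_ 0%N) /= /eqP; rewrite oner_eq0.
Qed.

HB.instance Definition _ := GRing.Zmodule_isComNzRing.Build (fps F)
  fps_mulA fps_mulC fps_mul1 fps_mulDl fps_one_neq0.

Lemma fpsDE f g n : (f + g) n = f n + g n. Proof. by []. Qed.
Lemma fpsNE f n : (- f) n = - f n. Proof. by []. Qed.
Lemma fps0E n : (0 : fps F) n = 0. Proof. by rewrite /= if_same. Qed.
Lemma fps1E n : (1 : fps F) n = (n == 0%N)%:R. Proof. by case: n. Qed.
Lemma fpsME f g n : (f * g) n = \sum_(i < n.+1) f i * g (n - i)%N.
Proof. by []. Qed.

Lemma fps_sumE I (r : seq I) (P : pred I) (G : I -> fps F) n :
  (\sum_(i <- r | P i) G i) n = \sum_(i <- r | P i) G i n.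
Proof.
by apply: (big_morph (fun f : fps F => f n)) => [f g|]; rewrite ?fps0E.
Qed.

Lemma fpsX_low g k n : g 0%N = 0 -> (n < k)%N -> (g ^+ k) n = 0.
Proof.
move=> g0; elim: k n => // k IHk n nk; rewrite exprS fpsME big1 // => -[i /= lt_in] _.
case: i lt_in => [|i]; first by rewrite g0 mul0r.
case: n nk => // n nk _; rewrite subSS IHk ?mulr0 //.
by apply: (leq_ltn_trans (leq_subr _ _)); move: nk; rewrite ltnS.
Qed.

(* Geometric series: if f 0 = a <> 0 and u = 1 - f / a, then
   1 / f = (1 / a) * (1 + u + u ^ 2 + ...). *)
Definition fps_inv f : fps F :=
  if f 0%N == 0 then f else
  Fps (fun n => (f 0%N)^-1 *
    (\sum_(k < n.+1) (1 - fps_const (f 0%N)^-1 * f) ^+ k) n).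

Definition fps_unit : {pred fps F} := fun f => f 0%N != 0.

Lemma fps_constM a f n : (fps_const a * f) n = a * f n.
Proof.
rewrite fpsME big_ord_recl /= subn0 big1 ?addr0 // => i _.
by rewrite mul0r.
Qed.

Lemma fps_mulVf : {in fps_unit, left_inverse 1 fps_inv *%R}.
Proof.
move=> f f0; rewrite /fps_inv (negbTE f0) mulrC.
set a := f 0%N; set u := 1 - _.
have u0 : u 0%N = 0 by rewrite fpsDE fpsNE fps_constM mulVf ?subrr.
have fE : f = fps_const a * (1 - u).
  by apply/fpsP => n; rewrite fps_constM /u opprB addrC subrK fps_constM mulVKf.
set s := Fps _.
have sE n i : (i <= n)%N -> a * s i = (\sum_(k < n.+1) u ^+ k) i.
  move=> le_in; rewrite mulVKf // !fps_sumE.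
  rewrite -!(big_mkord xpredT (fun k => (u ^+ k) i)).
  rewrite [RHS](big_cat_nat (n := i.+1)) //=.
  have -> : \sum_(i.+1 <= k < n.+1) (u ^+ k) i = 0; last by rewrite addr0.
  by rewrite big_nat big1 // => k /andP[ik _]; apply: fpsX_low.
have -> : f * s = (1 - u) * (fps_const a * s) by rewrite {1}fE mulrAC mulrC.
apply/fpsP => n.
have -> : ((1 - u) * (fps_const a * s)) n
        = ((1 - u) * \sum_(k < n.+1) u ^+ k) n.
  rewrite !fpsME; apply: eq_bigr => i _.
  by rewrite fps_constM (sE n) ?leq_subr.
rewrite -opprB mulNr -subrX1 opprB fpsDE fpsNE fpsX_low ?subr0 //.
Qed.

Lemma fps_unitPl f g : g * f = 1 -> fps_unit f.
Proof.
move=> /fpsP /(_ 0%N); rewrite fpsME big_ord1 fps1E /= /fps_unit => gf.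
by apply/eqP => f0; move/eqP: gf; rewrite f0 mulr0 eq_sym oner_eq0.
Qed.

Lemma fps_inv_out : {in [predC fps_unit], fps_inv =1 id}.
Proof. by move=> f; rewrite inE /fps_inv negbK => ->. Qed.

HB.instance Definition _ := GRing.ComNzRing_hasMulInverse.Build (fps F)
  fps_mulVf fps_unitPl fps_inv_out.

Definition fpsX : fps F := Fps (fun n => (n == 1%N)%:R).

(* Composition f(g(t)), meaningful only when g 0 = 0: then g ^+ k has no term
   of degree n for k > n, so the sum below is the full coefficient. *)
Definition fps_comp f g : fps F :=
  Fps (fun n => \sum_(k < n.+1) f k * (g ^+ k) n).

Lemma unit_1subX : 1 - fpsX \is a GRing.unit.
Proof. by rewrite unfold_in /= /fps_unit fpsDE fpsNE /= subr0 oner_neq0. Qed.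

End FpsRing.

Arguments fpsX {F}.

Section DegeneratePolyBernoulli.
Variable R : realType.

Definition gbinom (x : R) (k : nat) : R :=
  (\prod_(i < k) (x - i%:R)) / k`!%:R.

(* Unsigned Lah numbers L(n, k), for n >= k >= 1. *)
Definition lah (n k : nat) : R := 'C(n.-1, k.-1)%:R * (n`!%:R / k`!%:R).

Definition Li (m : int) (mu : R) : fps R :=
  Fps (fun n => if n == 0%N then 0
                else (-1) ^+ n.-1 / n%:R ^ m * gbinom (mu - 1) n.-1).

Definition Kseries (m : nat) (lambda : R) : fps R :=
  (-1 / (1 - fpsX)) * fps_comp (Li m%:Z (- lambda)) (- fpsX / (1 - fpsX)).

Definition K (m n : nat) (lambda : R) : R := Kseries m lambda n.

(* The defining identity: the series has no constant term. *)
Lemma K_def (m : nat) (lambda : R) :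
  (-1 / (1 - fpsX)) * fps_comp (Li m%:Z (- lambda)) (- fpsX / (1 - fpsX))
  = Fps (fun n => if n == 0%N then 0 else K m n lambda).
Proof.
apply/fpsP => -[|n] //; rewrite fpsME big_ord1 [X in _ * X]/=.
by rewrite big_ord1 mul0r mulr0.
Qed.

End DegeneratePolyBernoulli.

(* Main.v *)
(** Dividing a power series by [1 - t] replaces its coefficients by their
    partial sums; this yields the outer sum over [j], and, by the hockey-stick
    identity, [(t / (1 - t)) ^ k = \sum_j 'C(j - 1, k - 1) t ^ j], whose
    coefficients are [k! / j! L(j, k)].  The generalized binomials are matched
    by the reflection [binom(- x - 1, k) = (-1) ^ k binom(x + k, k)]. *)

Require Import Defs.
From mathcomp Require Import all_boot all_order all_algebra.
From mathcomp Require Import reals.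
From mathcomp Require Import ring.

Import GRing.Theory.
Local Open Scope ring_scope.

Section PowerSeries.
Variable F : fieldType.
Implicit Type f : fps F.

Lemma fps_mulXE f n : (f * fpsX) n = if n is n'.+1 then f n' else 0.
Proof.
rewrite mulrC fpsME big_ord_recl /= mul0r add0r.
case: n => [|n]; first by rewrite big_ord0.
rewrite big_ord_recl /= mul1r subSS subn0 big1 ?addr0 // => i _.
by rewrite mul0r.
Qed.

(** Multiplying the series of partial sums by [1 - fpsX] telescopes back to [f]. *)
Lemma fps_div1subXE f n : (f / (1 - fpsX)) n = \sum_(i < n.+1) f i.
Proof.
suff -> : f / (1 - fpsX) = Fps (fun n => \sum_(i < n.+1) f i) by [].
apply: (canLR (mulrK (unit_1subX F))); apply/fpsP => -[|k].
  by rewrite mulrBr mulr1 fpsDE fpsNE fps_mulXE subr0 /= big_ord1.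
by rewrite mulrBr mulr1 fpsDE fpsNE fps_mulXE /= big_ord_recr /= addrAC subrr add0r.
Qed.

Lemma fps_signME f k n : ((-1) ^+ k * f) n = (-1) ^+ k * f n.
Proof. by rewrite -signr_odd -[in RHS]signr_odd !mulr_sign; case: odd. Qed.

(** Induction on [k]: one more factor shifts the coefficients, then sums them. *)
Lemma fps_exp_X_div1subX k n :
  ((fpsX / (1 - fpsX) : fps F) ^+ k.+1) n.+1 = 'C(n, k)%:R.
Proof.
elim: k n => [|k IHk] n.
  rewrite expr1 fps_div1subXE bin0 !big_ord_recl /= add0r big1 ?addr0 //.
rewrite exprSr mulrA fps_div1subXE big_ord_recl fps_mulXE add0r.
under eq_bigr => i _ do rewrite fps_mulXE /=.
(* A positive power of a series without constant term vanishes in degree 0. *)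
rewrite big_ord_recl fpsX_low ?add0r //; last first.
  by rewrite fps_div1subXE big_ord1.
under eq_bigr => i _ do rewrite IHk.
elim: n => [|n IHn]; first by rewrite big_ord0 bin0n.
by rewrite big_ord_recr /= IHn binS natrD.
Qed.

End PowerSeries.

Lemma gbinomN (R : realType) (x : R) k :
  gbinom (- x - 1) k = (-1) ^+ k * gbinom (x + k%:R) k.
Proof.
rewrite /gbinom mulrA; congr (_ / _).
(* Up to sign the factors agree in opposite order: [- x - 1 - (k - 1 - i)] is [- (x + k - i)]. *)
rewrite (reindex_inj rev_ord_inj) /= -[in (-1) ^+ k](card_ord k) -prodrN.
apply: eq_bigr => i _; by rewrite natrB // -addn1 natrD; ring.
Qed.

Theorem theorem2p8 (R : realType) (lambda : R) (hlambda : lambda != 0)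
    (m n : nat) (hm : (1 <= m)%N) (hn : (1 <= n)%N) :
  K m n lambda =
    \sum_(1 <= j < n.+1) (j`!%:R)^-1 *
      \sum_(1 <= k < j.+1)
        (-1) ^+ k.-1 / k%:R ^+ m * gbinom (lambda + k%:R - 1) k.-1
          * k`!%:R * lah R j k.
Proof.
have fact_neq0 k : k`!%:R != 0 :> R by rewrite Num.Theory.pnatr_eq0 -lt0n fact_gt0.
rewrite /K /Kseries mulrAC fps_div1subXE mulN1r big_ord_recl fpsNE /=.
(* [Li] has no constant term, so degree 0 drops out; below, [j] and [k] stand for the indices [j.+1]
   and [k.+1]. *)
rewrite big_ord1 mul0r oppr0 add0r [RHS]big_add1 big_mkord.
apply: eq_bigr => j _; rewrite big_ord_recl mul0r add0r big_add1 big_mkord.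
rewrite mulr_sumr -sumrN; apply: eq_bigr => k _.
rewrite mulNr [(- (_ / _)) ^+ _]exprNn fps_signME fps_exp_X_div1subX /= gbinomN /lah.
rewrite -[_ + k.+1%:R - 1]addrA -natr1 addrK natr1 -exprnP.
rewrite exprS mulN1r.
(* The sign in [Li] cancels that of the reflection; the leading -1 absorbs one factor of
   [(-1) ^+ k.+1], leaving the [(-1) ^+ k] of the claim. *)
have -> : (-1) ^+ k / k.+1%:R ^+ m * ((-1) ^+ k * gbinom (lambda + k%:R) k)
   = gbinom (lambda + k%:R) k / k.+1%:R ^+ m :> R.
  by rewrite mulrACA -expr2 sqrr_sign mul1r mulrC.
have den_neq0 : k.+1%:R ^+ m != 0 :> R by rewrite expf_neq0 // Num.Theory.pnatr_eq0.
rewrite /=; move: den_neq0 (fact_neq0 j.+1) (fact_neq0 k.+1).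
move: (k.+1%:R ^+ m) (_`!%:R) (_`!%:R) => d a b d0 a0 b0.
by field; rewrite ?d0 ?a0 ?b0.
Qed.
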